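(* Let $D\subset D'$ be an extension of domains with quotient fields $K\subset K'$, respectively, such that $D'\cap K=D$. Let $p\in D[X]$ be monic and $d\in D$. Let $g\in D[X]$ be such that $g(X)$ is divisible in $D'[X]$ by $p(X)$ modulo $dD'[X]$. Then $g(X)$ is divisible in $D[X]$ by $p(X)$ modulo $dD[X]$.
   Context: For a domain $R$ and $g,p\in R[X]$, $d\in R$, ''$g$ is divisible in $R[X]$ by $p$ modulo $dR[X]$'' means $g\in p(X)R[X]+dR[X]$. *)

(* Defs.v *)
From HB Require Import structures.
From mathcomp Require Import all_boot all_order all_algebra.

Set Implicit Arguments.
Unset Strict Implicit.
Unset Printing Implicit Defensive.

Import GRing.Theory.
Local Open Scope ring_scope.

Definition divides_modulo (R : idomainType) (p : {poly R}) (d : R)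
    (g : {poly R}) : Prop :=
  exists u v : {poly R}, g = p * u + d%:P * v.

Notation tofrac := (@FracField.tofrac _).

(* Main.v *)
Require Import Defs.
From HB Require Import structures.
From mathcomp Require Import all_boot all_order all_algebra.

Set Implicit Arguments.
Unset Strict Implicit.
Unset Printing Implicit Defensive.

Import GRing.Theory.
Local Open Scope ring_scope.

(** Since p is monic, division with remainder by p is available over any ring.
    Two facts about it carry the proof. First, the remainder is linear in the
    dividend and vanishes on multiples of p, so g lies in p R[X] + d R[X] if
    and only if the remainder of g modulo p is a multiple of d
    ([divides_moduloP]). Second, by uniqueness, the remainder does not depend
    on the ring of coefficients in which the division is performed
    ([map_rmodp_monic]). The theorem is thereby reduced to a question about
    the coefficients of one polynomial over D: if d divides an element a of D
    within D', it must divide a within D. For d nonzero, the quotient a / d is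
    an element of K that belongs to D', hence to D ([dvd_descent]). *)

Import Pdiv.CommonRing Pdiv.RingMonic.

(** Because p is monic, its leading coefficient cannot be killed by f; so the
    image of the Euclidean division of g by p is again a Euclidean division,
    and uniqueness applies. *)
Lemma map_rmodp_monic (R S : nzRingType) (f : {rmorphism R -> S})
    (p g : {poly R}) :
  p \is monic ->
  map_poly f (rmodp g p) = rmodp (map_poly f g) (map_poly f p).
Proof.
move=> p_monic.
have size_fp : size (map_poly f p) = size p.
  by apply: size_map_poly_id0; rewrite (monicP p_monic) rmorph1 oner_neq0.
rewrite [in RHS](rdivp_eq p_monic g) rmorphD rmorphM /=.
rewrite rmodp_addl_mul_small ?monic_map // size_fp.
by apply: leq_ltn_trans (size_poly _ _) _; rewrite ltn_rmodpN0 ?monic_neq0.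
Qed.

Lemma divides_moduloP (R : idomainType) (p : {poly R}) (d : R)
    (g : {poly R}) :
  p \is monic ->
  divides_modulo p d g <-> exists w : {poly R}, rmodp g p = d *: w.
Proof.
move=> p_monic; split=> [[u [v ->]]|[w rem_g]].
  exists (rmodp v p).
  by rewrite mul_polyC mulrC rmodpD // rmodp_mull // add0r rmodpZ.
exists (rdivp g p), w.
by rewrite {1}(rdivp_eq p_monic g) rem_g mul_polyC mulrC.
Qed.

Lemma scale_poly_of_coef (R : nzRingType) (d : R) (r : {poly R}) :
  (forall k, exists c, r`_k = d * c) -> exists w : {poly R}, r = d *: w.
Proof.
move=> dvd_r.
have dvd_rb k : exists c, r`_k == d * c.
  by have [c ->] := dvd_r k; exists c.
exists (\poly_(k < size r) xchoose (dvd_rb k)).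
apply/polyP=> k; rewrite coefZ coef_poly; case: ltnP => [_|le_rk].
  exact/eqP/(xchooseP (dvd_rb k)).
by rewrite mulr0 nth_default.
Qed.

(** The quotient is a / d, computed in K; its image in K' is the given
    quotient b in D', so the intersection property puts it in D. *)
Lemma dvd_descent (D D' : idomainType) (i : {rmorphism D -> D'})
    (i_inj : injective i)
    (j : {rmorphism {fraction D} -> {fraction D'}})
    (j_ext : forall a : D, j (tofrac a) = tofrac (i a))
    (capK : forall z : {fraction D'},
       (exists a' : D', z = tofrac a') /\ (exists y : {fraction D}, z = j y) ->
       exists a : D, z = tofrac (i a))
    (a d : D) (b : D') :
  i a = i d * b -> exists c : D, a = d * c.
Proof.
move=> eq_ab; have [d0|d_neq0] := eqVneq d 0.
  exists 0; apply: i_inj.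
  by rewrite eq_ab d0 mulr0 rmorph0 mul0r.
have id_neq0 : tofrac (i d) != 0 by rewrite tofrac_eq0 raddf_eq0.
have [|c eq_bc] := capK (tofrac b).
  split; first by exists b.
  exists (tofrac a / tofrac d).
  by rewrite fmorph_div !j_ext eq_ab tofracM mulrAC divff // mul1r.
exists c; apply: i_inj; rewrite rmorphM eq_ab; congr (_ * _).
by apply/eqP; rewrite -tofrac_eq eq_bc.
Qed.

(* The inclusions D c D' and K c K' are the injections i and j, where
   K = {fraction D} and K' = {fraction D'}; D' n K = D is an equality of
   subsets of K', all of D, K, D' being identified with their images there. *)
Theorem lemma3p1 (D D' : idomainType) (i : {rmorphism D -> D'})
    (i_inj : injective i)
    (j : {rmorphism {fraction D} -> {fraction D'}})
    (j_ext : forall a : D, j (tofrac a) = tofrac (i a))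
    (D'capK : forall z : {fraction D'},
       (exists a' : D', z = tofrac a') /\ (exists y : {fraction D}, z = j y)
       <-> exists a : D, z = tofrac (i a))
    (p : {poly D}) (p_monic : p \is monic) (d : D) (g : {poly D})
    (g_div : divides_modulo (map_poly i p) (i d) (map_poly i g)) :
  divides_modulo p d g.
Proof.
have ip_monic : map_poly i p \is monic by rewrite monic_map.
have [w rem_ig] := (divides_moduloP _ _ ip_monic).1 g_div.
apply/(divides_moduloP _ _ p_monic)/scale_poly_of_coef => k.
apply: (dvd_descent i_inj j_ext (fun z => (D'capK z).1) (b := w`_k)).
by rewrite -coef_map map_rmodp_monic // rem_ig coefZ.
Qed.
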